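(* The Set-Fmla logic $\mathcal{PP}^{\Rightarrow_H}_{\le}$ is not determined by any single logical matrix. The same holds for the Set-Set logics $\mathcal{PP}^{\rhd,\Rightarrow_H}_{\le}$ and $\mathcal{PP}^{\rhd,\Rightarrow_H}_{\mathsf{up}}$.
   Context: Let $\mathcal{V}_6=\{\hat{\mathbf f},\mathbf f,\mathbf n,\mathbf b,\mathbf t,\hat{\mathbf t}\}$, partially ordered as a bounded distributive lattice by $\hat{\mathbf f}<\mathbf f<\mathbf n<\mathbf t<\hat{\mathbf t}$ and $\mathbf f<\mathbf b<\mathbf t$, with $\mathbf n,\mathbf b$ incomparable. $\mathbf{PP}_6$ is the algebra on $\mathcal V_6$ in the signature $\{\land,\lor,{\sim},\circ,\bot,\top\}$ where $\land,\lor$ are meet and join, $\bot=\hat{\mathbf f}$, $\top=\hat{\mathbf t}$, ${\sim}$ swaps $\mathbf f\leftrightarrow\mathbf t$ and $\hat{\mathbf f}\leftrightarrow\hat{\mathbf t}$ and fixes $\mathbf n,\mathbf b$, and ${\circ}a=\hat{\mathbf t}$ if $a\in\{\hat{\mathbf f},\hat{\mathbf t}\}$, ${\circ}a=\hat{\mathbf f}$ otherwise. $\mathbf{PP}_6^{\Rightarrow_H}$ expands $\mathbf{PP}_6$ by $a\Rightarrow b=\max\{c: a\land c\le b\}$. ${\uparrow}a=\{c: a\le c\}$. Logic of matrices: a (logical) matrix is $\langle\mathbf A,D\rangle$ with $\mathbf A$ an algebra of the signature and $D\subseteq A$; the Set-Set logic determined by a class $\mathcal M$ of matrices is: $\Phi\rhd\Psi$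 iff for every $\langle\mathbf A,D\rangle\in\mathcal M$ and homomorphism $h$ from formulas to $\mathbf A$, $h(\varphi)\notin D$ for some $\varphi\in\Phi$ or $h(\psi)\in D$ for some $\psi\in\Psi$; the Set-Fmla one: $\Phi\vdash\psi$ iff $\Phi\rhd\{\psi\}$. $\Phi\rhd^{\le}_{\mathsf K}\Psi$ iff for some finite $\Phi'\subseteq\Phi,\Psi'\subseteq\Psi$, $\bigwedge\Phi'\le\bigvee\Psi'$ is valid in $\mathsf K$ ($\bigwedge\varnothing=\top$, $\bigvee\varnothing=\bot$); $\mathcal{PP}^{\rhd,\Rightarrow_H}_{\le}$ is this logic for $\mathsf K=\mathbb V(\mathbf{PP}_6^{\Rightarrow_H})$ and $\mathcal{PP}^{\Rightarrow_H}_{\le}$ its Set-Fmla companion ($\Phi\vdash\psi$ iff $\Phi\rhd\{\psi\}$). $\mathcal{PP}^{\rhd,\Rightarrow_H}_{\mathsf{up}}$ is the Set-Set logic determined by the class $\{\langle\mathbf{PP}_6^{\Rightarrow_H},{\uparrow}a\rangle: a\in\mathcal V_6\}$. *)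

(* Defs.v *)
From Stdlib Require List.
From HB Require Import structures.
From mathcomp Require Import all_boot all_order.
From mathcomp Require Import classical_sets.

Set Implicit Arguments.
Unset Strict Implicit.
Unset Printing Implicit Defensive.

Import Order.TTheory.
Local Open Scope order_scope.
Local Open Scope classical_set_scope.

Record algebra : Type := Algebra {
  carrier :> Type;
  op_and : carrier -> carrier -> carrier;
  op_or : carrier -> carrier -> carrier;
  op_imp : carrier -> carrier -> carrier;
  op_neg : carrier -> carrier;
  op_circ : carrier -> carrier;
  op_bot : carrier;
  op_top : carrier }.

Record is_hom (A B : algebra) (h : A -> B) : Prop := IsHom {
  hom_and : forall x y, h (op_and x y) = op_and (h x) (h y);
  hom_or : forall x y, h (op_or x y) = op_or (h x) (h y);
  hom_imp : forall x y, h (op_imp x y) = op_imp (h x) (h y);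
  hom_neg : forall x, h (op_neg x) = op_neg (h x);
  hom_circ : forall x, h (op_circ x) = op_circ (h x);
  hom_bot : h (op_bot A) = op_bot B;
  hom_top : h (op_top A) = op_top B }.

Definition prod_algebra (I : Type) (A : I -> algebra) : algebra :=
  @Algebra (forall i, A i)
    (fun x y i => op_and (x i) (y i))
    (fun x y i => op_or (x i) (y i))
    (fun x y i => op_imp (x i) (y i))
    (fun x i => op_neg (x i))
    (fun x i => op_circ (x i))
    (fun i => op_bot (A i))
    (fun i => op_top (A i)).

(* The least class containing K and closed under homomorphic images,
   subalgebras (up to isomorphism) and arbitrary products. *)
Inductive variety (K : set algebra) : algebra -> Prop :=
| variety_gen (A : algebra) : K A -> variety K A
| variety_hom (A B : algebra) (h : A -> B) :
    variety K A -> is_hom h -> (forall y, exists x, h x = y) -> variety K B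
| variety_sub (A B : algebra) (h : B -> A) :
    variety K A -> is_hom h -> injective h -> variety K B
| variety_prod (I : Type) (A : I -> algebra) :
    (forall i, variety K (A i)) -> variety K (prod_algebra A).

Inductive form : Type :=
| Var of nat
| And of form & form
| Or of form & form
| Imp of form & form
| Neg of form
| Circ of form
| Bot
| Top.

Definition form_algebra : algebra := Algebra And Or Imp Neg Circ Bot Top.

Definition logic_ss := set form -> set form -> Prop.
Definition logic_sf := set form -> form -> Prop.

Definition companion (L : logic_ss) : logic_sf :=
  fun Phi psi => L Phi [set psi].

Record lmatrix : Type := LMatrix {
  mx_alg : algebra;
  mx_des : set mx_alg }.

Definition matrices_logic (C : set lmatrix) : logic_ss := fun Phi Psi =>
  forall M, C M -> forall h : form_algebra -> mx_alg M, is_hom h ->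
    (exists2 phi, Phi phi & ~ mx_des (h phi)) \/
    (exists2 psi, Psi psi & mx_des (h psi)).

Definition determined_ss (L : logic_ss) (M : lmatrix) : Prop :=
  forall Phi Psi, L Phi Psi <-> matrices_logic [set M] Phi Psi.

Definition determined_sf (L : logic_sf) (M : lmatrix) : Prop :=
  forall Phi psi, L Phi psi <-> companion (matrices_logic [set M]) Phi psi.

Definition valid_le (K : set algebra) (phi psi : form) : Prop :=
  forall A, K A -> forall h : form_algebra -> A, is_hom h ->
    op_and (h phi) (h psi) = h phi.

(* Finite subsets are given by lists of their elements. *)
Definition order_logic (K : set algebra) : logic_ss := fun Phi Psi =>
  exists s t : seq form,
    [/\ List.Forall Phi s, List.Forall Psi t &
        valid_le K (foldr And Top s) (foldr Or Bot t)].

(* Vhf and Vht are the hatted (bottom and top) values. *)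
Inductive V6 : Set := Vhf | Vf | Vn | Vb | Vt | Vht.

Definition V6_code (a : V6) : 'I_6 :=
  inord match a with
        | Vhf => 0 | Vf => 1 | Vn => 2 | Vb => 3 | Vt => 4 | Vht => 5
        end.
Definition V6_decode (i : 'I_6) : V6 := nth Vhf [:: Vhf; Vf; Vn; Vb; Vt; Vht] i.
Fact V6_codeK : cancel V6_code V6_decode.
Proof. by case; rewrite /V6_decode /V6_code inordK. Qed.

HB.instance Definition _ := Finite.copy V6 (can_type V6_codeK).

Definition V6_le (a b : V6) : bool :=
  match a, b with
  | Vhf, _ | _, Vht => true
  | Vf, (Vf | Vn | Vb | Vt) => true
  | Vn, (Vn | Vt) | Vb, (Vb | Vt) | Vt, Vt => true
  | _, _ => false
  end.

(* The only incomparable pair is Vn, Vb, with meet Vf and join Vt. *)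
Definition V6_meet (a b : V6) : V6 :=
  if V6_le a b then a else if V6_le b a then b else Vf.
Definition V6_join (a b : V6) : V6 :=
  if V6_le a b then b else if V6_le b a then a else Vt.

Fact V6_le_def a b : V6_le a b = (V6_meet a b == a).
Proof. by apply/idP/eqP; case: a; case: b. Qed.
Fact V6_meetC : commutative V6_meet. Proof. by do 2!case. Qed.
Fact V6_joinC : commutative V6_join. Proof. by do 2!case. Qed.
Fact V6_meetA : associative V6_meet. Proof. by do 3!case. Qed.
Fact V6_joinA : associative V6_join. Proof. by do 3!case. Qed.
Fact V6_joinKI b a : V6_meet a (V6_join a b) = a. Proof. by case: a; case: b. Qed.
Fact V6_meetKU b a : V6_join a (V6_meet a b) = a. Proof. by case: a; case: b. Qed.
Fact V6_meetUl : left_distributive V6_meet V6_join. Proof. by do 3!case. Qed.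

Fact V6_meetxx : idempotent_op V6_meet. Proof. by case. Qed.

Fact V6_display : Order.disp_t. Proof. exact: Order.Disp tt tt. Qed.

HB.instance Definition _ := Order.isMeetJoinDistrLattice.Build V6_display V6
  V6_le_def (fun _ _ => erefl) V6_meetC V6_joinC V6_meetA V6_joinA
  V6_joinKI V6_meetKU V6_meetUl V6_meetxx.

Fact V6_le0x a : Vhf <= a. Proof. by case: a. Qed.
Fact V6_lex1 a : a <= Vht. Proof. by case: a. Qed.

HB.instance Definition _ := Order.hasBottom.Build V6_display V6 V6_le0x.
HB.instance Definition _ := Order.hasTop.Build V6_display V6 V6_lex1.

Definition V6_neg (a : V6) : V6 :=
  match a with
  | Vhf => Vht | Vf => Vt | Vn => Vn | Vb => Vb | Vt => Vf | Vht => Vhf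
  end.

Definition V6_circ (a : V6) : V6 :=
  match a with Vhf | Vht => Vht | _ => Vhf end.

(* The maximum of {c | a `&` c <= b}; that this join is attained is V6_impP. *)
Definition V6_imp (a b : V6) : V6 := \join_(c : V6 | (a `&` c <= b)%O) c.

Lemma V6_impP (a b : V6) :
  (a `&` V6_imp a b <= b)%O /\
  forall c : V6, (a `&` c <= b)%O -> c <= V6_imp a b.
Proof.
split=> [|c ac_le_b]; last exact: joins_sup.
rewrite /V6_imp; apply: (big_ind (fun c : V6 => (a `&` c <= b)%O)) => // [|x y].
  by rewrite meetx0 le0x.
by rewrite meetUr leUx => -> ->.
Qed.

Definition PP6H : algebra :=
  @Algebra V6 Order.meet Order.join V6_imp V6_neg V6_circ \bot \top.

Definition PP_le_ss : logic_ss := order_logic (variety [set PP6H]).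

Definition PP_le_sf : logic_sf := companion PP_le_ss.

Definition PP_up_ss : logic_ss :=
  matrices_logic
    (range (fun a : V6 => @LMatrix PP6H [set c : V6 | a <= c])).

(* Main.v *)
From Stdlib Require List.
From mathcomp Require Import all_boot all_order.
From mathcomp Require Import boolp classical_sets.
Require Import Defs.

Set Implicit Arguments.
Unset Strict Implicit.
Unset Printing Implicit Defensive.

Import Order.TTheory.
Local Open Scope order_scope.
Local Open Scope classical_set_scope.

(** The logic of a single matrix has the cancellation property: two valuations
    refuting consequences with no variable in common can be glued into one
    refuting both.  The three logics violate cancellation.  Let [phi] be
    [x /\ ~x] and [psi] the prelinearity formula [(y => z) \/ (z => y)].  In
    [PP6H] every value of [phi] is below t and every value of [psi] is above t,
    so [phi] entails [psi]; but [psi] takes the value t at (n, b), so it is not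
    a theorem, and [phi] takes the value n at n, so it does not entail a fresh
    variable. *)

Fixpoint eval (A : algebra) (v : nat -> A) (phi : form) : A :=
  match phi with
  | Var n => v n
  | And f g => op_and (eval v f) (eval v g)
  | Or f g => op_or (eval v f) (eval v g)
  | Imp f g => op_imp (eval v f) (eval v g)
  | Neg f => op_neg (eval v f)
  | Circ f => op_circ (eval v f)
  | Bot => op_bot A
  | Top => op_top A
  end.

Lemma eval_is_hom (A : algebra) (v : nat -> A) :
  @is_hom form_algebra A (eval v).
Proof. by split. Qed.

Lemma hom_eval (A B : algebra) (h : A -> B) (v : nat -> A) (phi : form) :
  is_hom h -> h (eval v phi) = eval (h \o v) phi.
Proof.
case=> hand hor himp hneg hcirc hbot htop.
by elim: phi => //= [f <- g <-|f <- g <-|f <- g <-|f <-|f <-].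
Qed.

Lemma eval_Var (phi : form) : eval (A := form_algebra) Var phi = phi.
Proof. by elim: phi => //= [f -> g ->|f -> g ->|f -> g ->|f ->|f ->]. Qed.

Lemma form_homE (A : algebra) (h : form_algebra -> A) (phi : form) :
  is_hom h -> h phi = eval (h \o Var) phi.
Proof. by move=> hh; rewrite -(hom_eval _ _ hh) eval_Var. Qed.

Fixpoint vars (phi : form) : set nat :=
  match phi with
  | Var n => [set n]
  | And f g | Or f g | Imp f g => vars f `|` vars g
  | Neg f | Circ f => vars f
  | Bot | Top => set0
  end.

Definition set_vars (Phi : set form) : set nat := \bigcup_(phi in Phi) vars phi.

Lemma eq_in_eval (A : algebra) (v w : nat -> A) (phi : form) :
  (forall n, vars phi n -> v n = w n) -> eval v phi = eval w phi.
Proof.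
elim: phi => //= [n|f IHf g IHg|f IHf g IHg|f IHf g IHg|f IHf|f IHf] vw.
1: exact: vw.
4,5: by rewrite IHf.
all: by rewrite IHf ?IHg // => n n_in; apply: vw; [right | left].
Qed.

Definition refutes (M : lmatrix) (v : nat -> mx_alg M) (Phi Psi : set form) :
    Prop :=
  (forall phi, Phi phi -> mx_des (eval v phi)) /\
  (forall psi, Psi psi -> ~ mx_des (eval v psi)).

Lemma eq_in_refutes (M : lmatrix) (v w : nat -> mx_alg M) (Phi Psi : set form) :
    (forall n, set_vars (Phi `|` Psi) n -> v n = w n) ->
  refutes v Phi Psi -> refutes w Phi Psi.
Proof.
move=> vw [Phi_des Psi_undes]; split=> phi phi_in.
- rewrite -(@eq_in_eval _ v); first exact: Phi_des.
  by move=> n n_phi; apply: vw; exists phi => //; left.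
- rewrite -(@eq_in_eval _ v); first exact: Psi_undes.
  by move=> n n_phi; apply: vw; exists phi => //; right.
Qed.

Lemma refutesU (M : lmatrix) (v : nat -> mx_alg M)
    (Phi1 Phi2 Psi1 Psi2 : set form) :
    refutes v Phi1 Psi1 -> refutes v Phi2 Psi2 ->
  refutes v (Phi1 `|` Phi2) (Psi1 `|` Psi2).
Proof.
by move=> [des1 undes1] [des2 undes2];
  split=> phi [] phi_in; [apply: des1|apply: des2|apply: undes1|apply: undes2].
Qed.

Lemma matrices_logicPn (C : set lmatrix) (Phi Psi : set form) :
  ~ matrices_logic C Phi Psi <->
  exists2 M, C M & exists v : nat -> mx_alg M, refutes v Phi Psi.
Proof.
split=> [|[M CM [v [Phi_des Psi_undes]]]]; last first.
  by move=> /(_ M CM _ (eval_is_hom v)) [[phi /Phi_des]|[psi /Psi_undes]].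
move=> /existsNP[M /not_implyP[CM /existsNP[h /not_implyP[hh]]]].
move=> /not_orP[Phi_des Psi_undes]; exists M => //; exists (h \o Var).
split=> [phi phi_in|psi psi_in]; rewrite -form_homE //.
- by apply: contrapT => h_phi; apply: Phi_des; exists phi.
- by move=> h_psi; apply: Psi_undes; exists psi.
Qed.

Lemma matrices_logicS (C : set lmatrix) (Phi Phi' Psi Psi' : set form) :
    Phi `<=` Phi' -> Psi `<=` Psi' ->
  matrices_logic C Phi Psi -> matrices_logic C Phi' Psi'.
Proof.
move=> sPhi sPsi Phi_Psi M CM h hh.
have [[phi /sPhi]|[psi /sPsi]] := Phi_Psi M CM h hh.
- by left; exists phi.
- by right; exists psi.
Qed.

Lemma matrix_logic_cancel (M : lmatrix) (Phi1 Phi2 Psi1 Psi2 : set form) :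
    [disjoint set_vars (Phi1 `|` Psi1) & set_vars (Phi2 `|` Psi2)] ->
    matrices_logic [set M] (Phi1 `|` Phi2) (Psi1 `|` Psi2) ->
  matrices_logic [set M] Phi1 Psi1 \/ matrices_logic [set M] Phi2 Psi2.
Proof.
move=> /disj_setPS disj Phi_Psi; apply: contrapT => /not_orP[].
move=> /matrices_logicPn[_ -> [v1 ref1]] /matrices_logicPn[_ -> [v2 ref2]].
pose glue n := if n \in set_vars (Phi1 `|` Psi1) then v1 n else v2 n.
apply/(matrices_logicPn _ _ _).2: Phi_Psi; exists M => //; exists glue.
apply: refutesU.
- by apply: eq_in_refutes ref1 => n n1; rewrite /glue mem_set.
- apply: eq_in_refutes ref2 => n n2; rewrite /glue memNset // => n1.
  exact: (disj n).
Qed.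

Lemma determined_sf_cancel (L : logic_sf) (M : lmatrix) (Phi1 Phi2 : set form)
    (psi chi : form) :
    determined_sf L M ->
    [disjoint set_vars Phi1 & set_vars (Phi2 `|` [set psi])] ->
    L (Phi1 `|` Phi2) psi ->
  L Phi1 chi \/ L Phi2 psi.
Proof.
move=> LM disj /LM; rewrite /companion -[[set psi]]set0U => Phi_psi.
have [|Phi1_abs|Phi2_psi] := matrix_logic_cancel _ Phi_psi.
- by rewrite setU0.
- by left; apply/LM; apply: matrices_logicS Phi1_abs.
- by right; apply/LM.
Qed.

Lemma determined_companion (L : logic_ss) (M : lmatrix) :
  determined_ss L M -> determined_sf (companion L) M.
Proof. by move=> LM Phi psi; apply: LM. Qed.

Definition satisfies_eq (phi psi : form) (A : algebra) : Prop :=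
  forall v : nat -> A, eval v phi = eval v psi.

Lemma variety_satisfies_eq (K : set algebra) (phi psi : form) :
  K `<=` satisfies_eq phi psi -> variety K `<=` satisfies_eq phi psi.
Proof.
move=> K_eq A.
elim=> {A} [A|A B h _ A_eq hh h_surj v|A B h _ A_eq hh h_inj v|I A _ A_eq v].
- exact: K_eq.
- have [u hu] := choice (fun n => h_surj (v n)).
  have -> : v = h \o u by apply: funext => n; rewrite /= hu.
  by rewrite -!hom_eval // A_eq.
- by apply: h_inj; rewrite !hom_eval // A_eq.
- apply: functional_extensionality_dep => i.
  have proj_hom : @is_hom (prod_algebra A) (A i) (fun x => x i) by split.
  by rewrite !(hom_eval _ _ proj_hom) A_eq.
Qed.

Lemma valid_le_variety (K : set algebra) (phi psi : form) :
  valid_le K phi psi -> valid_le (variety K) phi psi.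
Proof.
move=> K_le A VA h hh; rewrite -(hom_and hh) !(form_homE _ hh).
apply: (@variety_satisfies_eq K (And phi psi) phi) => // B KB v.
exact: K_le KB _ (eval_is_hom v).
Qed.

Lemma le_hom_foldr_And (h : form_algebra -> PP6H) (a : V6) (s : seq form) :
    is_hom h ->
  a <= (h (foldr And Top s) : V6) <->
  List.Forall (fun phi => a <= (h phi : V6)) s.
Proof.
move=> hh; elim: s => [|phi s IHs] /=.
  by rewrite (hom_top hh) lex1; split.
by rewrite List.Forall_cons_iff -IHs (hom_and hh) lexI; split=> /andP.
Qed.

Lemma hom_foldr_Or_le (h : form_algebra -> PP6H) (a : V6) (s : seq form) :
    is_hom h ->
  (h (foldr Or Bot s) : V6) <= a <->
  List.Forall (fun phi => (h phi : V6) <= a) s.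
Proof.
move=> hh; elim: s => [|phi s IHs] /=.
  by rewrite (hom_bot hh) le0x; split.
by rewrite List.Forall_cons_iff -IHs (hom_or hh) leUx; split=> /andP.
Qed.

(** The Set-Set analogue fails: [x \/ y] entails [x, y] in the order logic, but
    the up-set of t is not prime, as the join of n and b is t. *)
Lemma companion_order_sub_up (K : set algebra) (Phi : set form) (psi : form) :
  K PP6H -> companion (order_logic K) Phi psi -> companion PP_up_ss Phi psi.
Proof.
move=> K_PP6H [s [t [sPhi t_psi s_le_t]]]; apply: contrapT.
move=> /matrices_logicPn[_ [a _ <-] [v [/= Phi_des psi_undes]]].
apply: (psi_undes psi) => //; have v_hom := eval_is_hom v.
have a_le_s : a <= (eval v (foldr And Top s) : V6).
  by apply/le_hom_foldr_And => //; apply: List.Forall_impl sPhi.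
have t_le_psi : (eval v (foldr Or Bot t) : V6) <= eval v psi.
  by apply/hom_foldr_Or_le => //; apply: List.Forall_impl t_psi => _ ->.
apply: le_trans a_le_s (le_trans _ t_le_psi).
by apply/meet_idPl; apply: s_le_t K_PP6H _ v_hom.
Qed.

Lemma le_V6_imp (a b c : V6) : (c <= V6_imp a b) = (a `&` c <= b)%O.
Proof.
have [imp_le imp_max] := V6_impP a b.
by apply/idP/idP => [/(leI2 (lexx a))/le_trans->|/imp_max].
Qed.

Lemma V6_imp_top (a b : V6) : a <= b -> V6_imp a b = \top.
Proof. by move=> ab; apply/eqP; rewrite -le1x le_V6_imp meetx1. Qed.

Lemma V6_imp_ge (a b : V6) : b <= V6_imp a b.
Proof. by rewrite le_V6_imp leIr. Qed.

Lemma V6_imp_incomparable (a b : V6) : a >< b -> V6_imp a b = b.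
Proof.
move=> ab; apply/le_anti; rewrite V6_imp_ge andbT.
have [+ _] := V6_impP a b.
by case: a ab; case: b => // _; case: (V6_imp _ _).
Qed.

Lemma V6_join_incomparable (a b : V6) : a >< b -> (a `|` b = Vt)%O.
Proof. by case: a; case: b. Qed.

Lemma V6_prelinearity_ge (a b : V6) : (Vt <= V6_imp a b `|` V6_imp b a)%O.
Proof.
have [/orP[ab|ba]|ab] := boolP (a >=< b).
- by rewrite (V6_imp_top ab) join1x lex1.
- by rewrite (V6_imp_top ba) joinx1 lex1.
- have ba : b >< a by rewrite comparable_sym.
  by rewrite !V6_imp_incomparable // V6_join_incomparable.
Qed.

Lemma V6_contradiction_le (a : V6) : (a `&` V6_neg a <= Vt)%O.
Proof. by case: a. Qed.

Definition contradiction : form := And (Var 0) (Neg (Var 0)).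

Definition prelinearity : form :=
  Or (Imp (Var 1) (Var 2)) (Imp (Var 2) (Var 1)).

Lemma contradiction_prelinearity_disjoint :
  [disjoint vars contradiction & vars prelinearity].
Proof. by apply/disj_setPS => n [/= [] -> [] []]. Qed.

Lemma PP_le_sf_contradiction_prelinearity :
  PP_le_sf [set contradiction] prelinearity.
Proof.
exists [:: contradiction], [:: prelinearity]; split; try by constructor.
apply: valid_le_variety => _ -> h hh; rewrite !(form_homE _ hh) /=.
apply/meet_idPl; rewrite meetx1 joinx0.
exact: le_trans (V6_contradiction_le _) (V6_prelinearity_ge _ _).
Qed.

Lemma PP_le_sf_sub_up (Phi : set form) (psi : form) :
  PP_le_sf Phi psi -> companion PP_up_ss Phi psi.
Proof. exact/companion_order_sub_up/variety_gen. Qed.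

Lemma PP_up_ss_prelinearityN : ~ PP_up_ss set0 [set prelinearity].
Proof.
apply/matrices_logicPn; exists (@LMatrix PP6H [set c : V6 | Vht <= c]).
  exact: imageT.
exists (fun n => if n == 1 then Vn else Vb : PP6H); split=> [//|_ -> /=].
by rewrite !V6_imp_incomparable.
Qed.

Lemma PP_up_ss_contradictionN : ~ PP_up_ss [set contradiction] [set Var 1].
Proof.
apply/matrices_logicPn; exists (@LMatrix PP6H [set c : V6 | Vn <= c]).
  exact: imageT.
by exists (fun n => if n == 0 then Vn else Vhf : PP6H); split=> _ ->.
Qed.

Lemma sub_up_not_determined_sf (L : logic_sf) :
    L [set contradiction] prelinearity ->
    (forall Phi psi, L Phi psi -> companion PP_up_ss Phi psi) ->
  ~ exists M : lmatrix, determined_sf L M.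
Proof.
rewrite -[[set contradiction]]setU0 => phi_psi L_up [M LM].
have [||] := determined_sf_cancel (Var 1) LM _ phi_psi.
- by rewrite set0U /set_vars !bigcup_set1 contradiction_prelinearity_disjoint.
- by move=> /L_up /PP_up_ss_contradictionN.
- by move=> /L_up /PP_up_ss_prelinearityN.
Qed.

Theorem theorem5p7 :
  ~ (exists M : lmatrix, determined_sf PP_le_sf M) /\
  ~ (exists M : lmatrix, determined_ss PP_le_ss M) /\
  ~ (exists M : lmatrix, determined_ss PP_up_ss M).
Proof.
have le_sfN : ~ exists M, determined_sf PP_le_sf M.
  apply: sub_up_not_determined_sf PP_le_sf_sub_up.
  exact: PP_le_sf_contradiction_prelinearity.
have up_sfN : ~ exists M, determined_sf (companion PP_up_ss) M.
  apply: sub_up_not_determined_sf => //.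
  exact/PP_le_sf_sub_up/PP_le_sf_contradiction_prelinearity.
split=> //; split=> -[M LM].
- by apply: le_sfN; exists M; apply: determined_companion LM.
- by apply: up_sfN; exists M; apply: determined_companion LM.
Qed.
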